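(* Let $p,q\ge 0$ be integers with $p+q=4$, and let $C\ell_{p,q}$ be the real Clifford algebra with orthogonal generators $e_1,e_2,e_3,e_4$, $e_k^2=\varepsilon_k$. Write an arbitrary element $A\in C\ell_{p,q}$ uniquely as $$A=\alpha+\vec b+\underline c+\beta e_{123}+(\alpha'+\vec b'+\underline c'+\beta' e_{123})e_4 ,$$ with $\alpha,\beta,\alpha',\beta'\in\mathbb{R}$, vectors $\vec b,\vec b'\in\mathrm{span}(e_1,e_2,e_3)$ and bivectors $\underline c,\underline c'\in\mathrm{span}(e_{23},e_{31},e_{12})$. Then the solutions of $A^2=-1$ are exactly given as follows. (1) If $\alpha\neq0$, there is no solution. (2) If $\alpha=0$ and $\alpha'\neq0$, then $A^2=-1$ if and only if $$\underline c=\tfrac1{\alpha'}\,\vec b'\wedge\vec b,\qquad \underline c'=\tfrac1{\alpha'}(\beta'\vec b'-\varepsilon_4\beta\vec b)\,e_{123},$$ and $$\vec b^2+\tfrac1{\alpha'^2}(\vec b'\wedge\vec b)^2+\beta^2e_{123}^2+\varepsilon_4\alpha'^2-\varepsilon_4\vec b'^2+\varepsilon_4\tfrac1{\alpha'^2}(\beta'\vec b'-\varepsilon_4\beta\vec b)^2e_{123}^2-\varepsilon_4\beta'^2e_{123}^2=-1 .$$ (3) If $\alpha=\alpha'=0$ and $\vec b'=0$: (3a) if $\beta=\beta'=0$, then $A^2=-1$ if and only if $\underline c\cdot\underline c'=0$, $\vec b\cdot\underline c'=0$, $\vec b\wedge\underline c=0$ and $\vec b^2+\underline c^2+\varepsilon_4\underline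 c'^2=-1$; (3b) if $\beta=0$ and $\beta'\neq0$, then $A^2=-1$ if and only if $\underline c=-\tfrac1{\beta'}(\vec b\cdot\underline c')\,e_{123}^{-1}$ and $$\vec b^2+\tfrac1{\beta'^2}(\vec b\cdot\underline c')^2e_{123}^2+\varepsilon_4\underline c'^2-\varepsilon_4\beta'^2e_{123}^2=-1;$$ (3c) if $\beta\neq0$, then $A^2=-1$ if and only if $\vec b=0$, $\underline c=0$ and $\beta^2e_{123}^2+\varepsilon_4\underline c'^2-\varepsilon_4\beta'^2e_{123}^2=-1$. (4) If $\alpha=\alpha'=0$ and $\vec b'\neq0$: (4a) if $\vec b=0$ and $\beta=0$, then $A^2=-1$ if and only if $\beta'=0$, $\underline c\cdot\underline c'=0$, $\vec b'\cdot\underline c'=0$, $\vec b'\wedge\underline c=0$ and $\underline c^2-\varepsilon_4\vec b'^2+\varepsilon_4\underline c'^2=-1$; (4b) if $\vec b=0$ and $\beta\neq0$, then $A^2=-1$ if and only if $\beta'=0$, $\underline c=-\tfrac{\varepsilon_4}{\beta}(\vec b'\cdot\underline c')\,e_{123}^{-1}$ and $$\tfrac1{\beta^2}(\vec b'\cdot\underline c')^2e_{123}^2+\beta^2e_{123}^2-\varepsilon_4\vec b'^2+\varepsilon_4\underline c'^2=-1;$$ (4c) if $\vec b\neq0$ and $\beta=0$, then $A^2=-1$ if and only if $\beta'=0$, $\underline c\cdot\underline c'=0$, $\vec b\wedge\underline c=0$, $\vec b\cdot\underline c'=0$, and there is $\gamma\in\mathbb{R}\setminus\{0\}$ with $\vec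 b'=\gamma\vec b$ and $(1-\varepsilon_4\gamma^2)\vec b^2+\underline c^2+\varepsilon_4\underline c'^2=-1$; (4d) if $\vec b\neq0$ and $\beta\neq0$, then $A^2=-1$ if and only if $\beta'\neq0$, $\vec b'=\varepsilon_4\tfrac{\beta}{\beta'}\vec b$, $\underline c=-\tfrac1{\beta'}(\vec b\cdot\underline c')\,e_{123}^{-1}$ and $$\Bigl(1-\varepsilon_4\tfrac{\beta^2}{\beta'^2}\Bigr)\vec b^2+\tfrac1{\beta'^2}(\vec b\cdot\underline c')^2e_{123}^2+\beta^2e_{123}^2+\varepsilon_4\underline c'^2-\varepsilon_4\beta'^2e_{123}^2=-1 .$$
   Context: For integers $p,q\ge0$ with $p+q=4$, $C\ell_{p,q}$ is the 16-dimensional real associative unital Clifford algebra generated by the vectors $e_1,\dots,e_4$ of an orthogonal basis of the inner product space $\mathbb{R}^{p,q}$, with relations $e_ie_j=-e_je_i$ for $i\neq j$ and $e_k^2=\varepsilon_k$, where $\varepsilon_k=+1$ for $1\le k\le p$ and $\varepsilon_k=-1$ for $p+1\le k\le 4$. Notation: $e_{12}=e_1e_2$, $e_{23}=e_2e_3$, $e_{31}=e_3e_1$, $e_{123}=e_1e_2e_3$; one has $e_{123}^2=-\varepsilon_1\varepsilon_2\varepsilon_3\in\{\pm1\}$. Juxtaposition and powers denote the Clifford (geometric) product. For vectors $\vec a,\vec b\in\mathrm{span}(e_1,e_2,e_3)$ and bivectors $\underline c,\underline c'\in\mathrm{span}(e_{23},e_{31},e_{12})$ the inner and outer products are $$\vec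 a\wedge\vec b=\tfrac12(\vec a\vec b-\vec b\vec a),\quad \vec b\cdot\underline c=\tfrac12(\vec b\,\underline c-\underline c\,\vec b),\quad \vec b\wedge\underline c=\tfrac12(\vec b\,\underline c+\underline c\,\vec b),\quad \underline c\cdot\underline c'=\tfrac12(\underline c\,\underline c'+\underline c'\underline c).$$ Here $\vec a\wedge\vec b$ is a bivector, $\vec b\cdot\underline c$ is a vector, $\vec b\wedge\underline c$ is a real multiple of $e_{123}$, and $\underline c\cdot\underline c'$ is a real number. The squares $\vec b^2$, $\underline c^2$ and $(\vec b'\wedge\vec b)^2$ are real numbers. Real numbers are identified with multiples of the unit element. *)

(* Defs.v *)
From HB Require Import structures.
From mathcomp Require Import all_boot all_order all_algebra all_field.

Set Implicit Arguments.
Unset Strict Implicit.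
Unset Printing Implicit Defensive.

Import GRing.Theory.

Local Open Scope ring_scope.

(* Generators are indexed from 0: the usual e_1, ..., e_4 are e 0, ..., e 3. *)
Definition eps (R : fieldType) (p : nat) (k : 'I_4) : R :=
  if (k < p)%N then 1 else -1.

(* A, with the generators e, is the Clifford algebra Cl_(p, 4 - p);
   these conditions determine the pair (A, e) up to isomorphism. *)
Definition clifford_algebra (R : fieldType) (A : falgType R) (p : nat)
    (e : 'I_4 -> A) : Prop :=
  [/\ forall i j, i != j -> e i * e j = - (e j * e i),
      forall k, e k ^+ 2 = (eps R p k)%:A,
      <<1 & [seq e k | k : 'I_4]>>%VS = fullv
    & \dim {:A} = 16%N].

Section Notions.
Variables (R : fieldType) (A : falgType R).

Definition e12 (e : 'I_4 -> A) : A := e 0 * e 1.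
Definition e23 (e : 'I_4 -> A) : A := e 1 * e 2.
Definition e31 (e : 'I_4 -> A) : A := e 2 * e 0.
Definition e123 (e : 'I_4 -> A) : A := e 0 * e 1 * e 2.

Definition vectors (e : 'I_4 -> A) : {vspace A} :=
  span [:: e 0; e 1; e 2].
Definition bivectors (e : 'I_4 -> A) : {vspace A} :=
  span [:: e23 e; e31 e; e12 e].

(* These formulas compute inner and outer products only for arguments of the
   grades given by the suffix (v: vector, b: bivector). *)
Definition wedge_vv (a b : A) : A := 2^-1 *: (a * b - b * a).
Definition dot_vb (b c : A) : A := 2^-1 *: (b * c - c * b).
Definition wedge_vb (b c : A) : A := 2^-1 *: (b * c + c * b).
Definition dot_bb (c c' : A) : A := 2^-1 *: (c * c' + c' * c).

Definition decomposition (e : 'I_4 -> A) (x : A)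
    (al : R) (b c : A) (be : R) (al' : R) (b' c' : A) (be' : R) : Prop :=
  [/\ b \in vectors e /\ b' \in vectors e,
      c \in bivectors e /\ c' \in bivectors e
    & x = al%:A + b + c + be *: e123 e
          + (al'%:A + b' + c' + be' *: e123 e) * e 3].

End Notions.

(* Main.v *)
Require Import Defs.
From HB Require Import structures.
From mathcomp Require Import all_boot all_order all_algebra all_field.
From mathcomp Require Import reals.
From mathcomp Require Import complex.
From Stdlib Require Ncring Ncring_tac.

Set Implicit Arguments.
Unset Strict Implicit.
Unset Printing Implicit Defensive.

Import GRing.Theory Num.Theory.

Local Open Scope ring_scope.

(* Write x = u + v e_4 with u, v in the subalgebra generated by e_1, e_2, e_3.
   Since e_4 u = u^ e_4 for the grade involution u^, one has
   x^2 = (u^2 + eps_4 v v^) + (u v + v u^) e_4, and e_123 is central in that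
   subalgebra. When the scalar part of x is zero, comparing the components of
   each grade turns x^2 = -1 into eight equations; in each case some of them
   are solved for c (and c') and imply the others, because the square of a
   vector or bivector is a scalar, so that x y - y x anticommutes with x.
   The scalar part of a solution is zero since it is 1/16 of the trace of right
   multiplication by x, a real matrix of square -1. *)

(** * Real matrices of square -1 and the trace of an algebra *)

(** Factor [P] as [C R] with [C] and [R] of full rank: cancelling them in [C R C R = C R] leaves
    [R C = 1], of size [\rank P], and the trace is cyclic. *)
Lemma mxtrace_idem (F : fieldType) n (P : 'M[F]_n) :
  P *m P = P -> \tr P = (\rank P)%:R.
Proof.
move=> PP; have CR := mulmx_base P.
suff RC : row_base P *m col_base P = 1%:M.
  by rewrite -[X in \tr X]CR mxtrace_mulC RC mxtrace1.
apply: (@row_free_inj _ _ _ _ (row_base P)); first exact: row_base_free.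
apply: (@row_full_inj _ _ _ _ (col_base P)); first exact: col_base_full.
by rewrite mul1mx -(mulmxA (row_base P)) mulmxA CR.
Qed.

(* Over R[i] the matrix (1 - i M) / 2 is idempotent, so its trace is a natural
   number; the imaginary part of that trace is - tr M / 2. *)
Lemma mxtrace_sqrN1 (R : rcfType) n (M : 'M[R]_n) :
  M *m M = - 1%:M -> \tr M = 0.
Proof.
move=> MM; pose N := map_mx (real_complex R) M.
pose Q := 'i%C *: N; pose P : 'M[R[i]]_n := 2^-1 *: (1%:M - Q).
have QQ : Q *m Q = 1%:M.
  rewrite -scalemxAl -scalemxAr scalerA -map_mxM MM map_mxN map_mx1.
  by rewrite -expr2 sqr_i scaleN1r opprK.
have /mxtrace_idem : P *m P = P.
  rewrite -scalemxAl -scalemxAr mulmxBl mul1mx mulmxBr mulmx1 QQ opprB -mulr2n.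
  by rewrite -[(_ - _) *+ 2](@scaler_nat R[i]) scalerK ?pnatr_eq0.
have two_neq0 : 2 != 0 :> R[i] by rewrite pnatr_eq0.
rewrite linearZ linearB /= mxtrace1 linearZ /= trace_map_mx.
move/(canRL (mulVKf two_neq0))/(congr1 (@complex.Im R)).
rewrite -natrM -!(rmorph_nat (real_complex R)) /= mul0r mul1r !add0r.
by move/eqP; rewrite oppr_eq0 => /eqP.
Qed.

Section AlgebraTrace.
Import VectorInternalTheory.
Variables (F : fieldType) (A : falgType F).

(** Matrices act on row vectors from the right, so right multiplication is the choice that preserves
    the order of products. *)
Definition rmul_mx (x : A) : 'M_(dim A) := lin1_mx (v2r \o amulr x \o r2v).

Lemma rmul_mxE x r : r *m rmul_mx x = v2r (r2v r * x).
Proof. by rewrite mul_rV_lin1 /= lfunE. Qed.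

Lemma rmul_mxM x y : rmul_mx (x * y) = rmul_mx x *m rmul_mx y.
Proof.
by apply/row_matrixP => i; rewrite !rowE mulmxA !rmul_mxE v2rK mulrA.
Qed.

Lemma rmul_mxD x y : rmul_mx (x + y) = rmul_mx x + rmul_mx y.
Proof.
by apply/row_matrixP => i; rewrite !rowE mulmxDr !rmul_mxE mulrDr linearD.
Qed.

Lemma rmul_mxZ a x : rmul_mx (a *: x) = a *: rmul_mx x.
Proof.
by apply/row_matrixP => i; rewrite !rowE -scalemxAr !rmul_mxE -scalerAr linearZ.
Qed.

Lemma rmul_mx1 : rmul_mx 1 = 1%:M.
Proof.
by apply/row_matrixP => i; rewrite !rowE rmul_mxE mulr1 r2vK mulmx1.
Qed.

Definition atrace (x : A) := \tr (rmul_mx x).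

Lemma atraceC x y : atrace (x * y) = atrace (y * x).
Proof. by rewrite /atrace !rmul_mxM mxtrace_mulC. Qed.

Lemma atraceD x y : atrace (x + y) = atrace x + atrace y.
Proof. by rewrite /atrace rmul_mxD linearD. Qed.

Lemma atraceZ a x : atrace (a *: x) = a * atrace x.
Proof. by rewrite /atrace rmul_mxZ linearZ. Qed.

Lemma atrace1 : atrace 1 = (\dim {:A})%:R.
Proof. by rewrite /atrace rmul_mx1 mxtrace1 dimvf. Qed.

End AlgebraTrace.

(** * Identities in noncommutative rings *)

(* The ring tactic cannot use commutation hypotheses: each identity is first
   completed with the commutators that the hypotheses annihilate. *)
Section NoncommutativeIdentities.
Variable T : pzRingType.

#[local] Instance pzRing_ops :
  @Ncring.Ring_ops T 0 1 +%R *%R (fun x y : T => x - y) -%R eq := {}.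

#[local] Instance pzRing_ring : Ncring.Ring (Ro := pzRing_ops).
Proof.
by split; try exact _; move=> *; rewrite /Algebra_syntax.equality /=;
  solve [exact: add0r | exact: addrC | exact: addrA | exact: mul1r
       | exact: mulr1 | exact: mulrA | exact: mulrDl | exact: mulrDr
       | exact: subrr | by []].
Qed.

(** The square of [u = b + c + d], where [d] stands for the multiple of [e123]. *)
Lemma sqrD3 (b c d : T) : d * b = b * d -> d * c = c * d ->
  (b + c + d) * (b + c + d) =
  b * b + c * c + d * d + (c * d + c * d) + (b * d + b * d) + (b * c + c * b).
Proof.
move=> db dc; suff -> : (b + c + d) * (b + c + d) =
  b * b + c * c + d * d + (c * d + c * d) + (b * d + b * d) + (b * c + c * b)
  + (d * b - b * d) + (d * c - c * d) by rewrite db dc !subrr !addr0.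
Ncring_tac.non_commutative_ring.
Qed.

(** The product of an element with its grade involution: the odd parts [b] and [d] change sign. *)
Lemma mul_grade_inv (a b c d : T) :
    a * b = b * a -> a * c = c * a -> a * d = d * a ->
    d * b = b * d -> d * c = c * d ->
  (a + b + c + d) * (a - b + c - d) =
  a * a + c * c - b * b - d * d + (b * c - c * b)
  + (a * c + a * c - (b * d + b * d)).
Proof.
move=> ab ac ad db dc; suff -> : (a + b + c + d) * (a - b + c - d) =
  a * a + c * c - b * b - d * d + (b * c - c * b)
  + (a * c + a * c - (b * d + b * d)) - (a * b - b * a) - (a * c - c * a)
  - (a * d - d * a) - (d * b - b * d) + (d * c - c * d).
  by rewrite ab ac ad db dc !subrr !subr0 addr0.
Ncring_tac.non_commutative_ring.
Qed.

(** The cofactor [u v + v u^] of [e_4], for [u] without scalar part. *)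
Lemma mul_twisted_comm (b c d a' b' c' d' : T) :
    a' * b = b * a' -> a' * c = c * a' -> a' * d = d * a' ->
    d * b' = b' * d -> d * c' = c' * d -> d * d' = d' * d ->
    d' * b = b * d' -> d' * c = c * d' ->
  (b + c + d) * (a' + b' + c' + d') + (a' + b' + c' + d') * (c - b - d) =
  c * c' + c' * c + (c * d' + c * d' + (b * c' - c' * b))
  + (a' * c + a' * c + (b * b' - b' * b)) + (b' * c + c * b').
Proof.
move=> ab ac ad db dc dd d'b d'c.
suff -> : (b + c + d) * (a' + b' + c' + d')
    + (a' + b' + c' + d') * (c - b - d) =
  c * c' + c' * c + (c * d' + c * d' + (b * c' - c' * b))
  + (a' * c + a' * c + (b * b' - b' * b)) + (b' * c + c * b')
  - (a' * b - b * a') - (a' * c - c * a') - (a' * d - d * a')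
  + (d * b' - b' * d) + (d * c' - c' * d) + (d * d' - d' * d)
  - (d' * b - b * d') + (d' * c - c * d').
  by rewrite ab ac ad db dc dd d'b d'c !subrr !subr0 !addr0.
Ncring_tac.non_commutative_ring.
Qed.

Lemma sqr_twisted (u v u' v' f : T) : f * u = u' * f -> f * v = v' * f ->
  (u + v * f) * (u + v * f) = u * u + v * v' * (f * f) + (u * v + v * u') * f.
Proof.
move=> fu fv; suff -> : (u + v * f) * (u + v * f) =
  u * u + v * v' * (f * f) + (u * v + v * u') * f
  + v * (f * u - u' * f) + v * (f * v - v' * f) * f.
  by rewrite fu fv !subrr !mulr0 mul0r !addr0.
Ncring_tac.non_commutative_ring.
Qed.

End NoncommutativeIdentities.

(** * The grade decomposition *)

Lemma memv_span3 (F : fieldType) (V : vectType F) (x y z v : V) :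
  v \in <<[:: x; y; z]>>%VS ->
  exists a1 a2 a3, v = a1 *: x + a2 *: y + a3 *: z.
Proof.
rewrite !span_cons span_nil addv0 addvA.
case/memv_addP=> _ /memv_addP[_ /vlineP[a1 ->] [_ /vlineP[a2 ->] ->]].
by case=> _ /vlineP[a3 ->] ->; exists a1, a2, a3.
Qed.

(* With k = 1 and k = -1 this reduces statements on anticommutators and
   commutators to generators. *)
Lemma span_comm_sub (F : fieldType) (A : falgType F) (k : F) (X Y : seq A)
    (U : {vspace A}) :
    {in X & Y, forall x y, x * y + k *: (y * x) \in U} ->
  {in <<X>>%VS & <<Y>>%VS, forall x y, x * y + k *: (y * x) \in U}.
Proof.
move=> XYU x y xX.
(* With one argument fixed the expression is linear in the other, so the condition defines a
   preimage of [U], a subspace, and can be tested on generators. *)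
have fE z w : (amull z + k *: amulr z)%VF w = z * w + k *: (w * z).
  by rewrite !lfunE /= !lfunE /= lfunE.
have gE z w : (amulr w + k *: amull w)%VF z = z * w + k *: (w * z).
  by rewrite !lfunE /= !lfunE /= lfunE.
rewrite -fE memv_preim; apply/subvP/span_subvP: y => y yY.
rewrite -memv_preim fE -gE memv_preim; apply/subvP/span_subvP: x xX => x xX.
by rewrite -memv_preim gE XYU.
Qed.

(** * Generators and the pseudoscalar [e123] *)

Section Clifford.
Variables (R : fieldType) (A : falgType R) (p : nat) (e : 'I_4 -> A).
Hypothesis cl : clifford_algebra p e.
Local Notation V := (vectors e).
Local Notation B := (bivectors e).
Local Notation J := (e123 e).
Local Notation ep := (eps R p).

Lemma eps_sqr k : ep k * ep k = 1.
Proof. by rewrite /eps; case: ifP; rewrite ?mulrNN mulr1. Qed.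

Lemma eps_neq0 k : ep k != 0.
Proof. by rewrite /eps; case: ifP; rewrite ?oppr_eq0 oner_eq0. Qed.

Lemma gen_anticomm i j : i != j -> e i * e j = - (e j * e i).
Proof. by case: cl => + _ _ _; apply. Qed.

Lemma gen_sqr k : e k * e k = (ep k)%:A.
Proof. by case: cl => _ + _ _ => /(_ k) <-. Qed.

Lemma gen_mulK k (a : A) : a * e k * e k = ep k *: a.
Proof. by rewrite -mulrA gen_sqr mulr_algr. Qed.

Lemma gen_mulKl k (a : A) : e k * (e k * a) = ep k *: a.
Proof. by rewrite mulrA gen_sqr mulr_algl. Qed.

Lemma gen_mulN i j (a : A) : i != j -> a * e i * e j = - (a * e j * e i).
Proof. by move=> /gen_anticomm ij; rewrite -!mulrA ij mulrN. Qed.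

Lemma gen0J : e 0 * J = ep 0 *: e23 e.
Proof. by rewrite /e123 !mulrA gen_sqr mulr_algl -scalerAl. Qed.

Lemma gen1J : e 1 * J = ep 1 *: e31 e.
Proof.
rewrite /e123 /e31 -[e 0 * _]opprK -gen_anticomm // mulNr -mulrA mulrN.
rewrite gen_mulKl.
by rewrite [e 2 * _]gen_anticomm // scalerN.
Qed.

Lemma gen2J : e 2 * J = ep 2 *: e12 e.
Proof.
rewrite /e123 /e12 !mulrA [e 2 * e 0]gen_anticomm // !mulNr.
by rewrite (@gen_mulN 2 1) // mulNr opprK gen_mulK.
Qed.

(** Moving [e k] past the three factors of [J] changes the sign twice, once for each factor other
    than [e k]. *)
Lemma gen_commJ (k : 'I_4) : (k < 3)%N -> J * e k = e k * J.
Proof.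
case: k => [[|[|[|//]]] k4] _.
- have ->: Ordinal k4 = 0 by apply: val_inj.
  rewrite gen0J /e123 (@gen_mulN 2 0) // (@gen_mulN 1 0) //.
  by rewrite gen_sqr mulr_algl mulNr opprK scalerAl.
- have ->: Ordinal k4 = 1 by apply: val_inj.
  rewrite gen1J /e123 (@gen_mulN 2 1) // gen_mulK.
  by rewrite /e31 [e 2 * _]gen_anticomm // scalerN -scalerAl.
- have ->: Ordinal k4 = 2 by apply: val_inj.
  by rewrite gen2J /e123 gen_mulK.
Qed.

(** Here all three factors of [J] contribute a sign. *)
Lemma gen3_anticommJ : e 3 * J = - (J * e 3).
Proof.
rewrite /e123 !mulrA [e 3 * e 0]gen_anticomm // !mulNr (@gen_mulN 3 1) // mulNr.
by rewrite (@gen_mulN 3 2) // opprK.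
Qed.

Definition sqJ := - (ep 0 * ep 1 * ep 2).

Lemma J_sqr : J * J = sqJ%:A.
Proof.
rewrite {1}/e123 -mulrA gen2J -scalerAr /e12 mulrA (@gen_mulN 1 0) // mulNr.
rewrite gen_mulK gen_sqr scalerN !scalerA /sqJ scaleNr.
by congr (- (_ *: _)); rewrite mulrC [ep 2 * _]mulrC mulrA.
Qed.

Lemma sqJ_sqr : sqJ * sqJ = 1.
Proof.
by rewrite /sqJ mulrNN mulrACA eps_sqr mulr1 mulrACA !eps_sqr mulr1.
Qed.

Lemma J_unit : J \is a GRing.unit.
Proof.
apply/unitrP; exists (sqJ *: J).
by rewrite -scalerAl -scalerAr J_sqr scalerA sqJ_sqr scale1r.
Qed.

Lemma J_inv : J^-1 = sqJ *: J.
Proof.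
apply: (mulrI J_unit).
by rewrite mulrV ?J_unit // -scalerAr J_sqr scalerA sqJ_sqr scale1r.
Qed.

(** * Vectors, bivectors and the grades of their products *)

Lemma mem_vectors_gen (k : 'I_4) : (k < 3)%N -> e k \in V.
Proof.
case: k => [[|[|[|//]]] k4] _; apply: memv_span; rewrite !inE.
- by rewrite (_ : Ordinal k4 = 0) ?eqxx //; apply: val_inj.
- by rewrite (_ : Ordinal k4 = 1) ?eqxx ?orbT //; apply: val_inj.
- by rewrite (_ : Ordinal k4 = 2) ?eqxx ?orbT //; apply: val_inj.
Qed.

Lemma genP (x : A) : x \in [:: e 0; e 1; e 2] -> exists2 k, x = e k & (k < 3)%N.
Proof. by rewrite !inE => /or3P[]/eqP->; [exists 0|exists 1|exists 2]. Qed.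

Lemma vectorsJ (a : A) : a \in V -> a * J \in B.
Proof.
case/memv_span3 => a1 [a2 [a3 ->]].
rewrite !mulrDl -!scalerAl gen0J gen1J gen2J.
by rewrite !memvD ?memvZ // memv_span // !inE eqxx ?orbT.
Qed.

(** Duality: multiplication by [J] exchanges vectors and bivectors, so statements on bivectors
    reduce to vectors. *)
Lemma bivectorsP (c : A) : c \in B -> exists2 a, a \in V & c = a * J.
Proof.
case/memv_span3 => a1 [a2 [a3 ->]].
(* The factors [ep k] cancel the signs in [e k * J], since they square to 1. *)
exists ((a1 * ep 0) *: e 0 + (a2 * ep 1) *: e 1 + (a3 * ep 2) *: e 2).
  by rewrite !memvD ?memvZ ?mem_vectors_gen.
rewrite !mulrDl -!scalerAl gen0J gen1J gen2J !scalerA -!mulrA !eps_sqr.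
by rewrite !mulr1.
Qed.

Lemma commJ_vectors (a : A) : a \in V -> a * J = J * a.
Proof.
case/memv_span3 => a1 [a2 [a3 ->]].
by rewrite !(mulrDl, mulrDr) -!scalerAl -!scalerAr !gen_commJ.
Qed.

Lemma anticomm3_vectors (a : A) : a \in V -> e 3 * a = - (a * e 3).
Proof.
case/memv_span3 => a1 [a2 [a3 ->]].
rewrite !(mulrDl, mulrDr) -!scalerAl -!scalerAr !(@gen_anticomm 3) //.
by rewrite !opprD !scalerN.
Qed.

Lemma bivectorsJ (c : A) : c \in B -> c * J \in V.
Proof.
by case/bivectorsP=> a aV ->; rewrite -mulrA J_sqr mulr_algr memvZ.
Qed.

Lemma commJ_bivectors (c : A) : c \in B -> c * J = J * c.
Proof. by case/bivectorsP=> a aV ->; rewrite mulrA (commJ_vectors aV). Qed.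

Lemma comm3_bivectors (c : A) : c \in B -> e 3 * c = c * e 3.
Proof.
case/bivectorsP=> a aV ->; rewrite mulrA anticomm3_vectors // mulNr.
by rewrite -(mulrA a (e 3)) gen3_anticommJ mulrN opprK mulrA.
Qed.

Lemma anticomm_vectors (a b : A) : a \in V -> b \in V -> a * b + b * a \in 1%VS.
Proof.
move=> aV bV; rewrite -[b * a]scale1r; apply: span_comm_sub aV bV => x y.
move=> /genP[i -> _] /genP[j -> _]; rewrite scale1r.
have [->|/gen_anticomm->] := eqVneq i j; last by rewrite addNr mem0v.
by rewrite gen_sqr memvD ?memvZ ?memv_line.
Qed.

Lemma comm_vectors (a b : A) : a \in V -> b \in V -> a * b - b * a \in B.
Proof.
move=> aV bV; rewrite -[b * a]scale1r -scaleNr; apply: span_comm_sub aV bV.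
have m01 : e 0 * e 1 \in B.
  by rewrite memv_span // !inE /e12 /e23 /e31 eqxx ?orbT.
have m12 : e 1 * e 2 \in B.
  by rewrite memv_span // !inE /e12 /e23 /e31 eqxx ?orbT.
have m20 : e 2 * e 0 \in B.
  by rewrite memv_span // !inE /e12 /e23 /e31 eqxx ?orbT.
have m10 : e 1 * e 0 \in B by rewrite gen_anticomm // memvN.
have m21 : e 2 * e 1 \in B by rewrite gen_anticomm // memvN.
have m02 : e 0 * e 2 \in B by rewrite gen_anticomm // memvN.
move=> x y; rewrite !inE scaleN1r.
by move=> /or3P[]/eqP-> /or3P[]/eqP->; rewrite ?subrr ?mem0v ?memvB.
Qed.

(** With [c = b * J] and [J] commuting with vectors, the commutator is [(a * b - b * a) * J], the
    dual of a bivector. *)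
Lemma comm_vector_bivector (a c : A) :
  a \in V -> c \in B -> a * c - c * a \in V.
Proof.
move=> aV /bivectorsP[b bV ->].
rewrite -[b * J * a]mulrA -(commJ_vectors aV) (mulrA a b) (mulrA b a) -mulrBl.
by rewrite bivectorsJ ?comm_vectors.
Qed.

Lemma anticomm_vector_bivector (a c : A) :
  a \in V -> c \in B -> a * c + c * a \in <[J]>%VS.
Proof.
move=> aV /bivectorsP[b bV ->].
rewrite -[b * J * a]mulrA -(commJ_vectors aV) (mulrA a b) (mulrA b a) -mulrDl.
have /vlineP[k ->] := anticomm_vectors aV bV.
by rewrite mulr_algl memvZ ?memv_line.
Qed.

Lemma anticomm_bivectors (c c' : A) :
  c \in B -> c' \in B -> c * c' + c' * c \in 1%VS.
Proof.
move=> /bivectorsP[a aV ->] /bivectorsP[b bV ->].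
have mulJJ u v : v \in V -> u * J * (v * J) = sqJ *: (u * v).
  move=> vV; rewrite (commJ_vectors vV) (mulrA _ J v) -(mulrA u J J) J_sqr.
  by rewrite mulr_algr scalerAl.
by rewrite !mulJJ // -scalerDr memvZ ?anticomm_vectors.
Qed.

(** * The sixteen blades form a basis *)

Local Notation even3 := [:: 1; e 0; e 1; e 2; e23 e; e31 e; e12 e; J].
Local Notation blades := (even3 ++ [seq (v * e 3)%R | v <- even3]).

Hypothesis two_neq0 : 2 != 0 :> R.

Lemma half_comm (a b : A) (U : {vspace A}) :
  a * b + b * a \in U -> a * b - b * a \in U -> a * b \in U.
Proof.
move=> abU baU; rewrite -(scalerK two_neq0 (a * b)) memvZ // scaler_nat mulr2n.
by rewrite -[X in X + _](addrK (b * a)) -addrA [- _ + _]addrC memvD.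
Qed.

(** The list [even3] holds the blades in the first three generators, odd ones included; here they
    are grouped by grade. *)
Lemma span_even3 : <<even3>>%VS = (1 + V + B + <[J]>)%VS.
Proof.
by rewrite /vectors /bivectors !span_cons span_nil !addv0 !addvA.
Qed.

(** Grade by grade: a product of two vectors is scalar plus bivector, bivector times vector is
    vector plus a multiple of [J], and [J] times a vector is a bivector. *)
Lemma span_even3_mulV : (<<even3>> * V <= <<even3>>)%VS.
Proof.
have sub1 : (1 <= <<even3>>)%VS by rewrite span_even3 -!addvA addvSl.
have subV : (V <= <<even3>>)%VS.
  by rewrite span_even3 -!addvA (subv_trans _ (addvSr _ _)) ?addvSl.
have subB : (B <= <<even3>>)%VS.
  by rewrite span_even3 (subv_trans _ (addvSl _ _)) ?addvSr.
have subJ : (<[J]> <= <<even3>>)%VS by rewrite span_even3 addvSr.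
apply/prodvP => x v + vV; rewrite {1}span_even3.
case/memv_addP=> _ /memv_addP[_ /memv_addP[_ /vlineP[k ->]
  [a aV ->]] [c cB ->]].
case=> _ /vlineP[l ->] ->; rewrite !mulrDl mulr_algl !memvD //.
- by rewrite memvZ // (subvP subV).
- apply: half_comm; first by rewrite (subvP sub1) ?anticomm_vectors.
  by rewrite (subvP subB) ?comm_vectors.
- apply: half_comm.
    by rewrite addrC (subvP subJ) ?anticomm_vector_bivector.
  by rewrite (subvP subV) // -memvN opprB comm_vector_bivector.
- by rewrite -scalerAl -commJ_vectors // memvZ ?(subvP subB) ?vectorsJ.
Qed.

(** The span contains 1 and is stable under right multiplication by each generator, hence contains
    the algebra they generate. *)
Lemma span_full : (<<blades>> = fullv)%VS.
Proof.
pose W := (<<even3>> + <<even3>> * <[e 3]>)%VS.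
have WE : W = <<blades>>%VS.
  by rewrite /W span_cat -limg_amulr limg_span; congr (_ + <<_>>)%VS;
     apply: eq_map => v; rewrite lfunE.
rewrite -WE; apply/eqP; rewrite eqEsubv subvf; case: cl => _ _ <- _.
apply: agenv_sub_modr.
  by rewrite (subv_trans _ (addvSl _ _)) // span_even3 -!addvA addvSl.
apply/prodvP => _ y /memv_addP[u uE [u' + ->]].
rewrite -limg_amulr => /memv_imgP[v vE ->] {u'}; rewrite lfunE /=.
have mulV a : a \in V -> (u + v * e 3) * a \in W.
  move=> aV; rewrite mulrDl -mulrA anticomm3_vectors // mulrN mulrA -mulNr.
  rewrite memv_add ?(subvP span_even3_mulV) ?memv_mul ?memv_line //.
  by rewrite memvN (subvP span_even3_mulV) ?memv_mul.
have mul3 : (u + v * e 3) * e 3 \in W.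
  rewrite addrC mulrDl gen_mulK.
  by rewrite memv_add ?memvZ ?memv_mul ?memv_line.
have mul1 : u + v * e 3 \in W by rewrite memv_add ?memv_mul ?memv_line.
case/memv_addP=> _ /vlineP[k ->] [z zE ->].
rewrite mulrDr mulr_algr memvD ?memvZ //.
have lE w : (u + v * e 3) * w = amull (u + v * e 3) w.
  by rewrite lfunE.
rewrite lE memv_preim; apply: subvP zE; apply/span_subvP => _ /codomP[i ->].
rewrite -memv_preim -lE.
have [i3|] := ltnP i 3; first by rewrite mulV ?mem_vectors_gen.
move=> i3; rewrite (_ : i = 3) //; apply/val_inj/anti_leq.
by rewrite i3 andbT -ltnS ltn_ord.
Qed.

(** Sixteen elements spanning a space of dimension 16. *)
Lemma blades_free : free blades.
Proof.
rewrite /free span_full; case: cl => _ _ _ ->.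
by rewrite size_cat size_map.
Qed.

Lemma decomposition0 al b c be al' b' c' be' :
  decomposition e 0 al b c be al' b' c' be' ->
  [/\ al = 0, b = 0, c = 0 & be = 0] /\ [/\ al' = 0, b' = 0, c' = 0 & be' = 0].
Proof.
case=> -[/memv_span3[b1 [b2 [b3 ->]]] /memv_span3[b1' [b2' [b3' ->]]]].
move=> [/memv_span3[c1 [c2 [c3 ->]]] /memv_span3[c1' [c2' [c3' ->]]]].
move=> dec0; have /freeP : free (in_tuple blades) := blades_free.
(* The coefficients, in the order of [blades]. *)
pose k := [:: al; b1; b2; b3; c1; c2; c3; be;
              al'; b1'; b2'; b3'; c1'; c2'; c3'; be'].
move/(_ (fun i => k`_i)).
rewrite !big_ord_recl big_ord0 /= mul1r => k0.
have k_eq0 i : (i < 16)%N -> k`_i = 0.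
  move=> i16; apply: (k0 _ (Ordinal i16)) => {i i16}.
  by rewrite [RHS]dec0 !(mulrDl, scalerAl) mulr_algl addr0 !addrA.
move: (k_eq0 0%N isT) (k_eq0 1%N isT) (k_eq0 2%N isT) (k_eq0 3%N isT).
move: (k_eq0 4%N isT) (k_eq0 5%N isT) (k_eq0 6%N isT) (k_eq0 7%N isT).
move: (k_eq0 8%N isT) (k_eq0 9%N isT) (k_eq0 10%N isT) (k_eq0 11%N isT).
move: (k_eq0 12%N isT) (k_eq0 13%N isT) (k_eq0 14%N isT) (k_eq0 15%N isT).
rewrite /k /= => -> -> -> -> -> -> -> -> -> -> -> -> -> -> -> ->.
by rewrite !scale0r !addr0.
Qed.

Lemma decomposition_inj x al b c be al' b' c' be'
    al1 b1 c1 be1 al1' b1' c1' be1' :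
    decomposition e x al b c be al' b' c' be' ->
    decomposition e x al1 b1 c1 be1 al1' b1' c1' be1' ->
  (al, b, c, be, (al', b', c', be')) =
  (al1, b1, c1, be1, (al1', b1', c1', be1')).
Proof.
move=> [[bV bV'] [cB cB'] xE] [[b1V b1V'] [c1B c1B'] x1E].
have [] := @decomposition0 (al - al1) (b - b1) (c - c1) (be - be1)
  (al' - al1') (b' - b1') (c' - c1') (be' - be1').
  have sum4B (a1 a2 a3 a4 d1 d2 d3 d4 : A) :
      a1 - d1 + (a2 - d2) + (a3 - d3) + (a4 - d4) =
      a1 + a2 + a3 + a4 - (d1 + d2 + d3 + d4).
    rewrite (addrACA a1) (addrACA (a1 + a2)) (addrACA (a1 + a2 + a3)).
    by rewrite !opprD.
  split; rewrite ?memvB // -(subrr x) {1}xE x1E !scalerBl !sum4B mulrBl.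
  by rewrite addrACA -opprD.
by move=> [/subr0_eq-> /subr0_eq-> /subr0_eq-> /subr0_eq->]
          [/subr0_eq-> /subr0_eq-> /subr0_eq-> /subr0_eq->].
Qed.

Lemma even3P u : u \in <<even3>>%VS -> exists al b c be,
  [/\ b \in V, c \in B & u = al%:A + b + c + be *: J].
Proof.
rewrite span_even3.
case/memv_addP=> _ /memv_addP[_ /memv_addP[_ /vlineP[al ->]
  [b bV ->]] [c cB ->]].
by case=> _ /vlineP[be ->] ->; exists al, b, c, be.
Qed.

Lemma decomposition_exists x : exists al b c be al' b' c' be',
  decomposition e x al b c be al' b' c' be'.
Proof.
have : x \in <<blades>>%VS by rewrite span_full memvf.
rewrite span_cat; case/memv_addP=> u /even3P[al [b [c [be [bV cB ->]]]]] [w].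
rewrite (_ : <<_>>%VS = (amulr (e 3) @: <<even3>>)%VS); last first.
  by rewrite limg_span; congr <<_>>%VS; apply: eq_map => v; rewrite lfunE.
case/memv_imgP=> _ /even3P[al' [b' [c' [be' [bV' cB' ->]]]]] ->.
by rewrite lfunE => ->; exists al, b, c, be, al', b', c', be'.
Qed.

(** * The equation x^2 = -1 *)

Lemma double_half (a : A) : (2^-1 *: a) + (2^-1 *: a) = a.
Proof. by rewrite -mulr2n -scaler_nat scalerA divff // scale1r. Qed.

Local Notation eps4 := (ep 3).

(** The terms are sorted by grade: scalar, vector, bivector, multiple of [J], then the cofactor of
    [e 3] in the same order. *)
Lemma sqr_decomposition (x b c : A) be al' (b' c' : A) be' :
    decomposition e x 0 b c be al' b' c' be' ->
  x * x =
    (b * b + c * c + be ^+ 2 *: (J * J) + eps4 *: ((al' ^+ 2)%:A + c' * c'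
       - b' * b' - be' ^+ 2 *: (J * J)))
    + 2 *: (be *: (c * J) + eps4 *: dot_vb b' c')
    + 2 *: (be *: (b * J) + eps4 *: (al' *: c' - be' *: (b' * J)))
    + 2 *: wedge_vb b c
    + (2 *: dot_bb c c' + 2 *: (be' *: (c * J) + dot_vb b c')
       + 2 *: (al' *: c + wedge_vv b b') + 2 *: wedge_vb b' c) * e 3.
Proof.
move=> [[bV bV'] [cB cB'] ->]; rewrite scale0r add0r.
have Jb a : a \in V -> J * a = a * J by move/commJ_vectors.
have Jc a : a \in B -> J * a = a * J by move/commJ_bivectors.
set d := be *: J; set d' := be' *: J; set a' := al'%:A.
have comd k a : J * a = a * J -> (k *: J) * a = a * (k *: J).
  by rewrite -scalerAl -scalerAr => ->.
have com1 y : a' * y = y * a' by rewrite mulr_algl mulr_algr.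
(* Grade involution: vectors and [J] change sign when moved past [e 3]; scalars and bivectors do
   not. *)
have u3 : e 3 * (b + c + d) = (c - b - d) * e 3.
  rewrite mulrDr mulrDr anticomm3_vectors // comm3_bivectors // /d -scalerAr.
  by rewrite gen3_anticommJ scalerN scalerAl !mulrBl [- _ + _]addrC.
have v3 : e 3 * (a' + b' + c' + d') = (a' - b' + c' - d') * e 3.
  rewrite !mulrDr -com1 anticomm3_vectors // comm3_bivectors // /d' -scalerAr.
  by rewrite gen3_anticommJ scalerN scalerAl !mulrBl !mulrDl mulNr.
rewrite (sqr_twisted u3 v3) gen_sqr mulr_algr.
have dV y a : a \in V -> (y *: J) * a = a * (y *: J) by move=> /Jb/comd.
have dB y a : a \in B -> (y *: J) * a = a * (y *: J) by move=> /Jc/comd.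
rewrite sqrD3; [|exact: dV|exact: dB].
rewrite mul_grade_inv; try solve [exact: com1 | exact: dV | exact: dB].
rewrite mul_twisted_comm;
  try solve [exact: com1 | exact: dV | exact: dB | exact/comd/esym/comd].
have two2 (y : A) : 2 *: y = y + y by rewrite scaler_nat mulr2n.
have half y : 2 *: (2^-1 *: y) = y :> A by rewrite scalerA divff ?scale1r.
have dM k y : y * (k *: J) = k *: (y * J) by rewrite -scalerAr.
have dd k : (k *: J) * (k *: J) = k ^+ 2 *: (J * J).
  by rewrite dM -scalerAl scalerA.
have a'M y : a' * y = al' *: y by rewrite mulr_algl.
rewrite /d /d' !dd !dM !a'M -!two2 /dot_vb /dot_bb /wedge_vv /wedge_vb.
have swap k y : 2 *: (k *: y) = k *: (2 *: y) :> A by rewrite !scalerA mulrC.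
rewrite /a' scalerA -(expr2 al').
rewrite !(scalerDr 2) !(swap eps4) !half !(scalerBr, scalerDr).
have regroup (x0 p0 q0 r0 y0 s0 t0 : A) :
    x0 + p0 + q0 + r0 + (y0 + s0 + t0) = x0 + y0 + (p0 + s0) + (q0 + t0) + r0.
  by rewrite (AC (4*3) (1*5*(2*6)*(3*7)*4)).
by rewrite regroup.
Qed.

(** * Comparison of components in the equation *)

Lemma scalar1P (z : A) : z \in 1%VS -> exists k, z = k%:A.
Proof. by move/vlineP. Qed.

Lemma vectors_sqr (a : A) : a \in V -> exists k, a * a = k%:A.
Proof.
move=> aV; apply: scalar1P.
by rewrite -(double_half (a * a)) -scalerDr memvZ ?anticomm_vectors.
Qed.

Lemma bivectors_sqr (c : A) : c \in B -> exists k, c * c = k%:A.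
Proof.
move=> cB; apply: scalar1P.
by rewrite -(double_half (c * c)) -scalerDr memvZ ?anticomm_bivectors.
Qed.

Lemma dot_vb_vector (a c : A) : a \in V -> c \in B -> dot_vb a c \in V.
Proof. by move=> aV cB; rewrite memvZ ?comm_vector_bivector. Qed.

Lemma wedge_vv_bivector (a b : A) : a \in V -> b \in V -> wedge_vv a b \in B.
Proof. by move=> aV bV; rewrite memvZ ?comm_vectors. Qed.

Lemma wedge_vb_J (a c : A) :
  a \in V -> c \in B -> exists k, wedge_vb a c = k *: J.
Proof.
by move=> aV cB; apply/vlineP; rewrite memvZ ?anticomm_vector_bivector.
Qed.

Lemma dot_bb_scalar (c c' : A) :
  c \in B -> c' \in B -> exists k, dot_bb c c' = k%:A.
Proof.
by move=> cB cB'; apply: scalar1P; rewrite memvZ ?anticomm_bivectors.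
Qed.

(* The scalar, vector, bivector and e_123 components of x^2 + 1: first of its
   part in the subalgebra generated by e_1, e_2, e_3, then of the cofactor of
   e_4. *)
Lemma sqr_eqN1P (x b c : A) be al' (b' c' : A) be' :
    decomposition e x 0 b c be al' b' c' be' ->
  x ^+ 2 = -1 <->
  [/\ b ^+ 2 + c ^+ 2 + be ^+ 2 *: J ^+ 2 + eps4 *: ((al' ^+ 2)%:A + c' ^+ 2
         - b' ^+ 2 - be' ^+ 2 *: J ^+ 2) = -1,
      be *: (c * J) + eps4 *: dot_vb b' c' = 0,
      be *: (b * J) + eps4 *: (al' *: c' - be' *: (b' * J)) = 0
    & wedge_vb b c = 0] /\
  [/\ dot_bb c c' = 0,
      be' *: (c * J) + dot_vb b c' = 0,
      al' *: c + wedge_vv b b' = 0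
    & wedge_vb b' c = 0].
Proof.
move=> dec; have := sqr_decomposition dec; rewrite -!expr2 => ->.
case: dec => [[bV bV'] [cB cB'] _].
set S := (X in X + _ + _ + _ + _); set v2 := (X in _ + 2 *: X + _ + _ + _).
set v3 := (X in _ + _ + 2 *: X + _ + _).
set w2 := (X in (_ + 2 *: X + _ + _) * _).
set w3 := (X in (_ + _ + 2 *: X + _) * _).
rewrite -/S -/v2 -/v3 -/w2 -/w3.
have [s Ss] : exists s, S + 1 = s%:A.
  rewrite /S !expr2.
  have [k1 ->] := vectors_sqr bV; have [k2 ->] := bivectors_sqr cB.
  have [k3 ->] := vectors_sqr bV'; have [k4 ->] := bivectors_sqr cB'.
  apply: scalar1P; rewrite J_sqr !(memvD, memvB, memvN, memvZ) ?memv_line //.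
have [k wE] := wedge_vb_J bV cB; have [k' wE'] := wedge_vb_J bV' cB.
have [m dE] := dot_bb_scalar cB cB'.
have v2V : v2 \in V.
  exact: memvD (memvZ _ (bivectorsJ cB)) (memvZ _ (dot_vb_vector bV' cB')).
have v3B : v3 \in B.
  apply: memvD (memvZ _ (vectorsJ bV)) (memvZ _ _).
  exact: memvB (memvZ _ cB') (memvZ _ (vectorsJ bV')).
have w2V : w2 \in V.
  exact: memvD (memvZ _ (bivectorsJ cB)) (dot_vb_vector bV cB').
have w3B : w3 \in B by exact: memvD (memvZ _ cB) (wedge_vv_bivector bV bV').
have half0 (y : A) : 2 *: y = 0 -> y = 0.
  by move/eqP; rewrite scaler_eq0 (negPf two_neq0) => /eqP.
split=> [x2|[[-> -> -> ->] [-> -> -> ->]]]; last first.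
  by rewrite !scaler0 !addr0 mul0r addr0.
(* The formula for [x ^+ 2 + 1] is a decomposition of 0, so each component vanishes. *)
have /decomposition0[[s0 /half0-> /half0-> k0] [m0 /half0-> /half0-> k'0]] :
    decomposition e 0 s (2 *: v2) (2 *: v3) (2 * k) (2 * m) (2 *: w2) (2 *: w3)
      (2 * k').
  split; rewrite ?memvZ // -!scalerA -wE -wE' -dE -Ss (addrAC S).
  rewrite (addrAC (S + _)) (addrAC (S + _ + _)) (addrAC (S + _ + _ + _)).
  by rewrite x2 addNr.
have wb0 : wedge_vb b c = 0 by apply: half0; rewrite wE scalerA k0 scale0r.
have wb'0 : wedge_vb b' c = 0 by apply: half0; rewrite wE' scalerA k'0 scale0r.
have dot0 : dot_bb c c' = 0 by apply: half0; rewrite dE scalerA m0 scale0r.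
by split; split=> //; apply/eqP; rewrite -addr_eq0 Ss s0 scale0r.
Qed.

(** The sum telescopes to [x * x * y - y * x * x], which is 0 because [x * x] is central. *)
Lemma commutator_anticomm (k : R) (x y : A) : x * x = k%:A ->
  x * (x * y - y * x) + (x * y - y * x) * x = 0.
Proof.
move=> xx; rewrite mulrBr mulrBl !mulrA addrA subrK -(mulrA y x x) xx.
by rewrite mulr_algl mulr_algr subrr.
Qed.

(** * Bilinearity and duality of the inner and outer products *)

Lemma wedge_vvC (a b : A) : wedge_vv a b = - wedge_vv b a.
Proof. by rewrite /wedge_vv -scalerN opprB. Qed.

Lemma wedge_vvv (a : A) : wedge_vv a a = 0.
Proof. by rewrite /wedge_vv subrr scaler0. Qed.

Lemma wedge_vvDr (a b c : A) : wedge_vv a (b + c) = wedge_vv a b + wedge_vv a c.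
Proof. by rewrite /wedge_vv mulrDl mulrDr opprD addrACA scalerDr. Qed.

Lemma wedge_vvZr k (a b : A) : wedge_vv a (k *: b) = k *: wedge_vv a b.
Proof. by rewrite /wedge_vv -scalerAl -scalerAr -scalerBr !scalerA mulrC. Qed.

Lemma wedge_vbZr k (a c : A) : wedge_vb a (k *: c) = k *: wedge_vb a c.
Proof. by rewrite /wedge_vb -scalerAl -scalerAr -scalerDr !scalerA mulrC. Qed.

Lemma wedge_vbZl k (a c : A) : wedge_vb (k *: a) c = k *: wedge_vb a c.
Proof. by rewrite /wedge_vb -scalerAl -scalerAr -scalerDr !scalerA mulrC. Qed.

Lemma wedge_vbDl (a b c : A) : wedge_vb (a + b) c = wedge_vb a c + wedge_vb b c.
Proof. by rewrite /wedge_vb mulrDl mulrDr addrACA scalerDr. Qed.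

Lemma dot_vbZr k (a c : A) : dot_vb a (k *: c) = k *: dot_vb a c.
Proof. by rewrite /dot_vb -scalerAl -scalerAr -scalerBr !scalerA mulrC. Qed.

Lemma dot_vbZl k (a c : A) : dot_vb (k *: a) c = k *: dot_vb a c.
Proof. by rewrite /dot_vb -scalerAl -scalerAr -scalerBr !scalerA mulrC. Qed.

Lemma dot_bbZl k (c d : A) : dot_bb (k *: c) d = k *: dot_bb c d.
Proof. by rewrite /dot_bb -scalerAl -scalerAr -scalerDr !scalerA mulrC. Qed.

Lemma dot_bbZr k (c d : A) : dot_bb c (k *: d) = k *: dot_bb c d.
Proof. by rewrite /dot_bb -scalerAl -scalerAr -scalerDr !scalerA mulrC. Qed.

Lemma dot_vb0l (c : A) : dot_vb 0 c = 0.
Proof. by rewrite /dot_vb mul0r mulr0 subr0 scaler0. Qed.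

Lemma wedge_vb0l (c : A) : wedge_vb 0 c = 0.
Proof. by rewrite /wedge_vb mul0r mulr0 addr0 scaler0. Qed.

Lemma wedge_vb0r (c : A) : wedge_vb c 0 = 0.
Proof. by rewrite /wedge_vb mul0r mulr0 addr0 scaler0. Qed.

Lemma dot_bb0l (c : A) : dot_bb 0 c = 0.
Proof. by rewrite /dot_bb mul0r mulr0 addr0 scaler0. Qed.

Lemma wedge_vv0l (a : A) : wedge_vv 0 a = 0.
Proof. by rewrite /wedge_vv mul0r mulr0 subr0 scaler0. Qed.

Lemma wedge_vv0r (a : A) : wedge_vv a 0 = 0.
Proof. by rewrite wedge_vvC wedge_vv0l oppr0. Qed.

Lemma dot_vbJ (a b : A) : a \in V -> dot_vb a (b * J) = wedge_vv a b * J.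
Proof.
move=> aV; rewrite /dot_vb /wedge_vv -scalerAl mulrBl; congr (_ *: (_ - _)).
  exact: mulrA.
by rewrite -(mulrA b J) -(commJ_vectors aV) (mulrA b a J).
Qed.

Lemma wedge_vbJ (a b : A) : a \in V ->
  wedge_vb a (b * J) = 2^-1 *: (a * b + b * a) * J.
Proof.
move=> aV; rewrite /wedge_vb -scalerAl mulrDl; congr (_ *: (_ + _)).
  exact: mulrA.
by rewrite -(mulrA b J) -(commJ_vectors aV) (mulrA b a J).
Qed.

Lemma dot_bbJ (b c : A) : c \in B ->
  dot_bb (b * J) c = wedge_vb b c * J.
Proof.
move=> cB; rewrite /wedge_vb /dot_bb -scalerAl mulrDl; congr (_ *: (_ + _)).
  by rewrite -(mulrA b J) -(commJ_bivectors cB) (mulrA b c J).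
exact: mulrA.
Qed.

Lemma dot_bbC (c c' : A) : dot_bb c c' = dot_bb c' c.
Proof. by rewrite /dot_bb addrC. Qed.

Lemma wedge_vb_wedge (a b : A) : a \in V -> wedge_vb a (wedge_vv a b) = 0.
Proof.
move=> /vectors_sqr[k /commutator_anticomm aa].
by rewrite wedge_vbZr /wedge_vb aa !scaler0.
Qed.

Lemma wedge_vb_dotVJ (a c : A) : a \in V ->
  wedge_vb a (dot_vb a c * J^-1) = 0.
Proof.
move=> aV; have /vectors_sqr[k /commutator_anticomm aa] := aV.
rewrite J_inv -scalerAr wedge_vbZr wedge_vbJ // /dot_vb -scalerAr -!scalerAl.
by rewrite -scalerDr aa !scaler0 mul0r !scaler0.
Qed.

Lemma dot_bb_dotVJ (a c : A) : c \in B -> dot_bb (dot_vb a c * J^-1) c = 0.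
Proof.
move=> cB; have /bivectors_sqr[k /commutator_anticomm cc] := cB.
(* The commutator is reversed to [c * a - a * c], which anticommutes with [c]. *)
rewrite J_inv -scalerAr dot_bbZl dot_bbJ // /wedge_vb /dot_vb -opprB scalerN.
rewrite mulrN mulNr -opprD -scalerAr -!scalerAl -scalerDr addrC cc.
by rewrite scaler0 oppr0 mul0r !scaler0.
Qed.

(** As [J^-1] is [J] up to sign, both have the same square. *)
Lemma sqr_vectorVJ (a : A) : a \in V -> (a * J^-1) ^+ 2 = a ^+ 2 * J ^+ 2.
Proof.
move=> aV; rewrite J_inv -scalerAr exprZn expr2 sqJ_sqr scale1r.
by rewrite exprMn_comm //; apply: commJ_vectors.
Qed.

Lemma sqr_vectorJ (a : A) : a \in V -> (a * J) ^+ 2 = a ^+ 2 * J ^+ 2.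
Proof. by move=> aV; rewrite exprMn_comm //; apply: commJ_vectors. Qed.

(** * Solving the component equations for [c] and for [b'] *)

Lemma mulJ_eq0 (a : A) : a * J = 0 -> a = 0.
Proof. by move=> aJ; apply: (mulIr J_unit); rewrite mul0r. Qed.

Lemma solve_mulJ k (a c : A) : k != 0 ->
  k *: (c * J) + a = 0 <-> c = - (k^-1 *: (a * J^-1)).
Proof.
move=> k0; split=> [/eqP|->]; last first.
  by rewrite mulNr -scalerAl mulrVK ?J_unit // scalerN scalerA divff //
    scale1r addNr.
rewrite addr_eq0 => /eqP/(canRL (scalerK k0)) cJ; apply: (mulIr J_unit).
by rewrite cJ mulNr -scalerAl mulrVK ?J_unit // scalerN.
Qed.

(** Such a [c] is a multiple of the commutator of [a] and [c'] times [J^-1]; it anticommutes with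
    both, so two more component equations hold automatically. *)
Lemma dotVJ_sol k (a c c' : A) : a \in V -> c' \in B ->
    c = - (k *: (dot_vb a c' * J^-1)) ->
  [/\ c ^+ 2 = k ^+ 2 *: (dot_vb a c' ^+ 2 * J ^+ 2), wedge_vb a c = 0
    & dot_bb c c' = 0].
Proof.
move=> aV cB' ->; rewrite sqrrN exprZn sqr_vectorVJ ?dot_vb_vector //.
rewrite -scaleNr wedge_vbZr wedge_vb_dotVJ // dot_bbZl dot_bb_dotVJ //.
by rewrite !scaler0.
Qed.

(** A generator at which [a] has a nonzero coordinate serves as [v], the generators being orthogonal
    with nonzero squares. *)
Lemma vectors_nondegenerate (a : A) : a \in V -> a != 0 ->
  exists v m, [/\ v \in V, m != 0 & a * v + v * a = m%:A].
Proof.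
case/memv_span3=> a1 [a2 [a3 aE]] a_neq0.
have aM v : a * v + v * a = a1 *: (e 0 * v + v * e 0)
    + a2 *: (e 1 * v + v * e 1) + a3 *: (e 2 * v + v * e 2).
  rewrite aE !mulrDl !mulrDr -!scalerAl -!scalerAr addrACA.
  by rewrite (addrACA (a1 *: _)) !scalerDr.
have eM i j : e i * e j + e j * e i = (if i == j then 2 * ep j else 0)%:A.
  have [->|/gen_anticomm->] := eqVneq i j; last by rewrite addNr scale0r.
  by rewrite gen_sqr -scalerA scaler_nat.
have ep2_neq0 k : 2 * ep k != 0 by rewrite mulf_neq0 ?eps_neq0.
have [a1_0|a1_neq0] := eqVneq a1 0; last first.
  exists (e 0), (a1 * (2 * ep 0)); rewrite mem_vectors_gen // mulf_neq0 //.
  by rewrite aM !eM /= scale0r !scaler0 !addr0 scalerA.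
have [a2_0|a2_neq0] := eqVneq a2 0; last first.
  exists (e 1), (a2 * (2 * ep 1)); rewrite mem_vectors_gen // mulf_neq0 //.
  by rewrite aM !eM /= scale0r !scaler0 add0r !addr0 scalerA.
have [a3_0|a3_neq0] := eqVneq a3 0; last first.
  exists (e 2), (a3 * (2 * ep 2)); rewrite mem_vectors_gen // mulf_neq0 //.
  by rewrite aM !eM /= scale0r !scaler0 !add0r scalerA.
by rewrite aE a1_0 a2_0 a3_0 !scale0r !addr0 eqxx in a_neq0.
Qed.

(* Here a may be a null vector, so b is not recovered by dividing by a^2 but by
   computing (a v + v a) b, with a b scalar and v chosen so that a v + v a is
   invertible. *)
Lemma wedge_vv_eq0 (a b : A) : a \in V -> b \in V -> a != 0 ->
  wedge_vv a b = 0 -> exists k, b = k *: a.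
Proof.
move=> aV bV /(vectors_nondegenerate aV)[v [m [vV m0 av]]] /eqP.
rewrite scaler_eq0 invr_eq0 (negPf two_neq0) subr_eq0 => /eqP abC.
have /scalar1P[l ab] : a * b \in 1%VS.
  by rewrite -(double_half (a * b)) -scalerDr {2}abC memvZ ?anticomm_vectors.
have /scalar1P[n /(canRL (addrK _)) vb] := anticomm_vectors vV bV.
(* With [v b = n - b v] and [a b = l], the product [m b = (a v + v a) b] is [n a - l v + l v]. *)
exists (m^-1 * n); rewrite -scalerA; apply: (canRL (scalerK m0)).
rewrite -mulr_algl -av mulrDl -!mulrA vb mulrBr mulr_algr (mulrA a b) ab.
by rewrite mulr_algl mulr_algr subrK.
Qed.

(** * Solutions with zero scalar part *)

Section Cases.
Variables (x b c b' c' : A) (be al' be' : R).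
Hypothesis dec : decomposition e x 0 b c be al' b' c' be'.

Let bV : b \in V. Proof. by case: dec => -[]. Qed.
Let b'V : b' \in V. Proof. by case: dec => -[]. Qed.
Let cB : c \in B. Proof. by case: dec => _ []. Qed.
Let c'B : c' \in B. Proof. by case: dec => _ []. Qed.

(** The two bivector equations contain [al' *: c] and [al' *: c'], so they determine [c] and
    [c']. *)
Lemma sqr_eqN1_case2 : al' != 0 ->
  x ^+ 2 = -1 <->
  [/\ c = al'^-1 *: wedge_vv b' b,
      c' = al'^-1 *: ((be' *: b' - (eps4 * be) *: b) * J)
    & b ^+ 2 + (al' ^+ 2)^-1 *: wedge_vv b' b ^+ 2
      + be ^+ 2 *: J ^+ 2 + (eps4 * al' ^+ 2)%:A - eps4 *: b' ^+ 2
      + (eps4 / al' ^+ 2) *: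
          ((be' *: b' - (eps4 * be) *: b) ^+ 2 * J ^+ 2)
      - (eps4 * be' ^+ 2) *: J ^+ 2 = -1].
Proof.
move=> al'_neq0; set y := be' *: b' - (eps4 * be) *: b.
have yV : y \in V by rewrite memvB ?memvZ.
have sumE : c = al'^-1 *: wedge_vv b' b -> c' = al'^-1 *: (y * J) ->
    b ^+ 2 + c ^+ 2 + be ^+ 2 *: J ^+ 2 + eps4 *: ((al' ^+ 2)%:A + c' ^+ 2
         - b' ^+ 2 - be' ^+ 2 *: J ^+ 2) =
    b ^+ 2 + (al' ^+ 2)^-1 *: wedge_vv b' b ^+ 2
      + be ^+ 2 *: J ^+ 2 + (eps4 * al' ^+ 2)%:A - eps4 *: b' ^+ 2
      + (eps4 / al' ^+ 2) *: (y ^+ 2 * J ^+ 2) - (eps4 * be' ^+ 2) *: J ^+ 2.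
  move=> -> ->; rewrite !exprZn sqr_vectorJ // !exprVn !scalerBr !scalerDr.
  by rewrite !scalerA !addrA (addrAC _ (_ *: (_ * _))).
have c'_sum : be *: (b * J) + eps4 *: (al' *: c' - be' *: (b' * J)) =
    eps4 *: (al' *: c' - y * J).
  rewrite /y mulrBl -!scalerAl !scalerBr !scalerA (mulrA eps4) eps_sqr mul1r.
  rewrite opprB.
  exact: addrCA.
split=> [/(sqr_eqN1P dec)[[sum _ c'E _] [_ _ cE _]]|[cE c'E]].
  have {}cE : c = al'^-1 *: wedge_vv b' b.
    apply: (canRL (scalerK al'_neq0)); apply/eqP.
    by rewrite wedge_vvC -addr_eq0 cE.
  have {}c'E : c' = al'^-1 *: (y * J).
    apply: (canRL (scalerK al'_neq0)); apply/eqP; rewrite -subr_eq0.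
    by move/eqP: c'E; rewrite c'_sum scaler_eq0 (negPf (eps_neq0 _)).
  by split=> //; rewrite -sumE.
rewrite -sumE // => sum; apply/(sqr_eqN1P dec).
(* The other equations follow since [wedge_vv b' b] anticommutes with [b] and [b']; in the two
   vector equations its multiples cancel. *)
have wV : wedge_vv b' b \in B by apply: wedge_vv_bivector.
have w0 : wedge_vb b (wedge_vv b' b) = 0.
  by rewrite wedge_vvC -scaleN1r wedge_vbZr wedge_vb_wedge ?scaler0.
have w'0 : wedge_vb b' (wedge_vv b' b) = 0 by apply: wedge_vb_wedge.
have c3 : be *: (b * J) + eps4 *: (al' *: c' - be' *: (b' * J)) = 0.
  by rewrite c'_sum c'E scalerA divff // scale1r subrr scaler0.
split; split=> //; rewrite ?cE ?c'E.
- rewrite dot_vbZr dot_vbJ // /y wedge_vvDr -scaleNr !wedge_vvZr wedge_vvv.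
  rewrite scaler0 add0r; move: (wedge_vv b' b) => w.
  rewrite -!scalerAl !scalerA -scalerDl mulrN mulrACA eps_sqr mul1r mulrC subrr.
  by rewrite scale0r.
- by rewrite wedge_vbZr w0 scaler0.
- rewrite dot_bbZr dot_bbZl dot_bbC dot_bbJ // /y wedge_vbDl -scaleNr.
  by rewrite !wedge_vbZl w0 w'0 !scaler0 addr0 mul0r !scaler0.
- rewrite dot_vbZr dot_vbJ // /y wedge_vvDr -scaleNr !wedge_vvZr wedge_vvv.
  rewrite scaler0 addr0 (wedge_vvC b b'); move: (wedge_vv b' b) => w.
  by rewrite scalerN mulNr -!scalerAl scalerN !scalerA mulrC subrr.
- by rewrite scalerA divff // scale1r (wedge_vvC b b') subrr.
- by rewrite wedge_vbZr w'0 scaler0.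
Qed.

Hypothesis al'0 : al' = 0.

(** Once [al'] vanishes, [J] can be cancelled from the first bivector equation, leaving a
    proportionality between [b] and [b']. *)
Lemma sqr_eqN1_al'0 :
  x ^+ 2 = -1 <->
  [/\ b ^+ 2 + c ^+ 2 + be ^+ 2 *: J ^+ 2 + eps4 *: (c' ^+ 2
         - b' ^+ 2 - be' ^+ 2 *: J ^+ 2) = -1,
      be *: (c * J) + eps4 *: dot_vb b' c' = 0,
      be *: b = (eps4 * be') *: b'
    & wedge_vb b c = 0] /\
  [/\ dot_bb c c' = 0, be' *: (c * J) + dot_vb b c' = 0,
      wedge_vv b b' = 0 & wedge_vb b' c = 0].
Proof.
have b3 : be *: (b * J) + eps4 *: (0 *: c' - be' *: (b' * J)) = 0 <->
    be *: b = (eps4 * be') *: b'.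
  rewrite scale0r sub0r scalerN scalerA !scalerAl -mulrBl.
  split=> [/mulJ_eq0/subr0_eq // | ->]; by rewrite subrr mul0r.
have sumE : (0 ^+ 2)%:A + c' ^+ 2 = c' ^+ 2 :> A.
  by rewrite expr0n scale0r add0r.
have cE : 0 *: c + wedge_vv b b' = wedge_vv b b' by rewrite scale0r add0r.
move: dec; rewrite al'0 => /sqr_eqN1P; rewrite sumE cE => sqrP.
by split=> [/sqrP|] [[h1 h2 /b3 h3 h4] h5]; [|apply/sqrP].
Qed.


Let sqr0R : 0 ^+ 2 = 0 :> R. Proof. by rewrite expr0n. Qed.
Let sqr0A : 0 ^+ 2 = 0 :> A. Proof. by rewrite expr0n. Qed.
Let simp0 := (sqr0R, sqr0A, scale0r, scaler0, mul0r, mulr0, subr0, addr0, add0r,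
  dot_vb0l, wedge_vb0l, wedge_vb0r, dot_bb0l, wedge_vv0l, wedge_vv0r).

Lemma sqr_eqN1_case3a : b' = 0 -> be = 0 -> be' = 0 ->
  x ^+ 2 = -1 <->
  [/\ dot_bb c c' = 0, dot_vb b c' = 0, wedge_vb b c = 0
    & b ^+ 2 + c ^+ 2 + eps4 *: c' ^+ 2 = -1].
Proof.
move=> b'0 be0 be'0; have := sqr_eqN1_al'0; rewrite b'0 be0 be'0 !simp0 => ->.
by split=> [[[? ? ? ?] [? ? ? ?]]|[? ? ? ?]].
Qed.

Lemma sqr_eqN1_case3b : b' = 0 -> be = 0 -> be' != 0 ->
  x ^+ 2 = -1 <->
  c = - (be'^-1 *: (dot_vb b c' * J^-1)) /\
  b ^+ 2 + (be' ^+ 2)^-1 *: (dot_vb b c' ^+ 2 * J ^+ 2)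
  + eps4 *: c' ^+ 2 - (eps4 * be' ^+ 2) *: J ^+ 2 = -1.
Proof.
move=> b'0 be0 be'_neq0; have := sqr_eqN1_al'0; rewrite b'0 be0 !simp0 => ->.
rewrite scalerBr scalerA addrA.
split=> [[[sum _ _ _] [_ /(solve_mulJ _ _ be'_neq0) cE _ _]]|[cE]].
  by have [cc _ _] := dotVJ_sol bV c'B cE; rewrite -exprVn -cc.
have [cc wbc dcc'] := dotVJ_sol bV c'B cE; rewrite -exprVn -cc => sum.
by do 2?split=> //; apply/(solve_mulJ _ _ be'_neq0).
Qed.

Lemma sqr_eqN1_case3c : b' = 0 -> be != 0 ->
  x ^+ 2 = -1 <->
  [/\ b = 0, c = 0
    & be ^+ 2 *: J ^+ 2 + eps4 *: c' ^+ 2 - (eps4 * be' ^+ 2) *: J ^+ 2 = -1].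
Proof.
move=> b'0 be_neq0; have := sqr_eqN1_al'0; rewrite b'0 !simp0 => ->.
rewrite scalerBr scalerA addrA.
split=> [[[sum /eqP + /eqP + _] _]|[b0 c0 sum]]; last first.
  by rewrite b0 c0 !simp0.
rewrite !scaler_eq0 (negPf be_neq0) => /eqP/mulJ_eq0 c0 /eqP b0.
by move: sum; rewrite b0 c0 !simp0.
Qed.

Lemma sqr_eqN1_case4a : b' != 0 -> b = 0 -> be = 0 ->
  x ^+ 2 = -1 <->
  [/\ be' = 0, dot_bb c c' = 0, dot_vb b' c' = 0, wedge_vb b' c = 0
    & c ^+ 2 - eps4 *: b' ^+ 2 + eps4 *: c' ^+ 2 = -1].
Proof.
move=> b'_neq0 b0 be0; have := sqr_eqN1_al'0; rewrite b0 be0 !simp0 => ->.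
split=> [[[sum /eqP + /esym/eqP + _] [? _ _ ?]]|[-> ? -> ?]]; last first.
  by rewrite !simp0 scalerBr addrAC addrA => sum; do 2?split.
rewrite scaler_eq0 (negPf (eps_neq0 _)) => /eqP db'.
(* The proportionality reads [(eps4 * be') *: b' = 0], so [be'] vanishes. *)
rewrite scaler_eq0 mulf_eq0 (negPf b'_neq0) (negPf (eps_neq0 _)) orbF.
move=> /eqP be'0; move: sum.
by rewrite be'0 !simp0 scalerBr addrA addrAC.
Qed.

Lemma sqr_eqN1_case4b : b' != 0 -> b = 0 -> be != 0 ->
  x ^+ 2 = -1 <->
  [/\ be' = 0, c = - ((eps4 / be) *: (dot_vb b' c' * J^-1))
    & (be ^+ 2)^-1 *: (dot_vb b' c' ^+ 2 * J ^+ 2)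
      + be ^+ 2 *: J ^+ 2 - eps4 *: b' ^+ 2 + eps4 *: c' ^+ 2 = -1].
Proof.
move=> b'_neq0 b0 be_neq0; have := sqr_eqN1_al'0; rewrite b0 !simp0 => ->.
(* The sign disappears from the squared coefficient. *)
have sqr_coef : (eps4 / be) ^+ 2 = (be ^+ 2)^-1.
  by rewrite exprMn [eps4 ^+ 2]eps_sqr mul1r exprVn.
have cP : be *: (c * J) + eps4 *: dot_vb b' c' = 0 <->
    c = - ((eps4 / be) *: (dot_vb b' c' * J^-1)).
  apply: (iff_trans (solve_mulJ _ _ be_neq0)).
  by rewrite -scalerAl scalerA [_ / be]mulrC.
split=> [[[sum /cP cE /esym/eqP + _] _]|[be'0 cE]].
  rewrite scaler_eq0 mulf_eq0 (negPf b'_neq0) (negPf (eps_neq0 _)) orbF.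
  move/eqP=> be'0; split=> //; have [cc _ _] := dotVJ_sol b'V c'B cE.
  by move: sum; rewrite -sqr_coef -cc be'0 !simp0 scalerBr addrA addrAC.
have [cc wbc dcc'] := dotVJ_sol b'V c'B cE; rewrite -sqr_coef -cc => sum.
rewrite be'0 !simp0 scalerBr addrA addrAC.
by do 2?split=> //; apply/cP.
Qed.

(** The proportionality only gives [be' = 0]; the factor [ga] comes from [wedge_vv b b' = 0], and is
    nonzero because [b'] is. *)
Lemma sqr_eqN1_case4c : b' != 0 -> b != 0 -> be = 0 ->
  x ^+ 2 = -1 <->
  [/\ be' = 0, dot_bb c c' = 0, wedge_vb b c = 0, dot_vb b c' = 0
    & exists ga : R,
        [/\ ga != 0, b' = ga *: b
          & (1 - eps4 * ga ^+ 2) *: b ^+ 2 + c ^+ 2 + eps4 *: c' ^+ 2 = -1]].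
Proof.
move=> b'_neq0 b_neq0 be0; have := sqr_eqN1_al'0; rewrite be0 !simp0 => ->.
have sumE ga : (1 - eps4 * ga ^+ 2) *: b ^+ 2 + c ^+ 2 + eps4 *: c' ^+ 2 =
    b ^+ 2 + c ^+ 2 + eps4 *: (c' ^+ 2 - (ga *: b) ^+ 2).
  rewrite exprZn scalerBl scale1r scalerBr scalerA (addrAC (b ^+ 2)) -!addrA.
  by congr (_ + (_ + _)); rewrite addrC.
split=> [[[sum _ /esym/eqP + ?] [? + bb' ?]]|[be'0 ? wbc dbc [ga [_ b'E]]]].
  rewrite scaler_eq0 mulf_eq0 (negPf b'_neq0) (negPf (eps_neq0 _)) orbF.
  move=> /eqP be'0; rewrite be'0 !simp0 => ?.
  have [ga b'E] := wedge_vv_eq0 bV b'V b_neq0 bb'.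
  split=> //; exists ga; split=> //.
    by apply: contraNneq b'_neq0 => ga0; rewrite b'E ga0 scale0r.
  by rewrite sumE -b'E -sum be'0 !simp0.
rewrite sumE b'E dot_vbZl wedge_vvZr wedge_vvv wedge_vbZl wbc dbc be'0 !simp0.
by do 2?split.
Qed.

Lemma sqr_eqN1_case4d : b' != 0 -> b != 0 -> be != 0 ->
  x ^+ 2 = -1 <->
  [/\ be' != 0, b' = (eps4 * (be / be')) *: b,
      c = - (be'^-1 *: (dot_vb b c' * J^-1))
    & (1 - eps4 * (be ^+ 2 / be' ^+ 2)) *: b ^+ 2
      + (be' ^+ 2)^-1 *: (dot_vb b c' ^+ 2 * J ^+ 2)
      + be ^+ 2 *: J ^+ 2 + eps4 *: c' ^+ 2
      - (eps4 * be' ^+ 2) *: J ^+ 2 = -1].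
Proof.
move=> b'_neq0 b_neq0 be_neq0; rewrite sqr_eqN1_al'0.
have b'P : be' != 0 ->
    be *: b = (eps4 * be') *: b' <-> b' = (eps4 * (be / be')) *: b.
  move=> be'_neq0; have coefK : (eps4 * be') * (eps4 * (be / be')) = be.
    by rewrite mulrACA eps_sqr mul1r mulrC divfK.
  split=> [|->]; last by rewrite scalerA coefK.
  rewrite -{1}coefK -scalerA => /scalerI-> //.
  by rewrite mulf_neq0 ?eps_neq0.
have sumE : b' = (eps4 * (be / be')) *: b ->
    b ^+ 2 + c ^+ 2 + be ^+ 2 *: J ^+ 2
      + eps4 *: (c' ^+ 2 - b' ^+ 2 - be' ^+ 2 *: J ^+ 2) =
    (1 - eps4 * (be ^+ 2 / be' ^+ 2)) *: b ^+ 2 + c ^+ 2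
      + be ^+ 2 *: J ^+ 2 + eps4 *: c' ^+ 2 - (eps4 * be' ^+ 2) *: J ^+ 2.
  move=> ->; rewrite exprZn exprMn [eps4 ^+ 2]eps_sqr mul1r exprMn exprVn.
  rewrite scalerBl scale1r !scalerBr !scalerA.
  rewrite (AC (3*3) (1*5*2*3*4*6)) //=.
split=> [[[sum _ b'E _] [_ cE _ _]]|[be'_neq0 b'E cE]].
  (* Otherwise [be *: b] would be 0. *)
  have be'_neq0 : be' != 0.
    apply: contraNneq b_neq0 => be'0; move/eqP: b'E.
    by rewrite be'0 mulr0 scale0r scaler_eq0 (negPf be_neq0).
  move/(b'P be'_neq0): b'E => b'E; move/(solve_mulJ _ _ be'_neq0): cE => cE.
  have [cc _ _] := dotVJ_sol bV c'B cE; rewrite exprVn in cc.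
  by split=> //; rewrite -cc -sumE.
have [cc wbc dcc'] := dotVJ_sol bV c'B cE.
rewrite exprVn in cc; rewrite -cc -sumE // => sum.
move/(solve_mulJ _ _ be'_neq0): cE => cE.
do 2?split=> //; first 1 last.
- exact/b'P.
- by rewrite b'E wedge_vvZr wedge_vvv scaler0.
- by rewrite b'E wedge_vbZl wbc scaler0.
(* The first vector equation is [be / be'] times the second. *)
rewrite b'E dot_vbZl scalerA (mulrA eps4) eps_sqr mul1r.
have -> : be *: (c * J) = (be / be') *: (be' *: (c * J)).
  by rewrite scalerA divfK.
by rewrite -scalerDr cE scaler0.
Qed.

End Cases.

(** * The scalar part *)

(** By cyclicity [a * g * g] and [g * a * g] have the same trace, while anticommutation makes them
    opposite; [g * g] is a nonzero scalar. *)
Lemma atrace_anticomm k (g a : A) :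
  g * g = k%:A -> k != 0 -> g * a = - (a * g) -> atrace a = 0.
Proof.
move=> gg k_neq0 ga; have: atrace (a * g * g) = - atrace (a * g * g).
  by rewrite {1}atraceC mulrA ga mulNr -scaleN1r atraceZ mulN1r.
rewrite -mulrA gg mulr_algr atraceZ => /eqP.
rewrite -addr_eq0 -mulr2n -mulr_natl !mulf_eq0 (negPf two_neq0).
by rewrite (negPf k_neq0) => /eqP.
Qed.

Lemma atrace_gen_mul i j : i != j -> atrace (e i * e j) = 0.
Proof.
move=> /gen_anticomm ij; apply/eqP.
have: atrace (e i * e j) = - atrace (e i * e j).
  by rewrite {1}ij -scaleN1r atraceZ mulN1r atraceC.
by move/eqP; rewrite -addr_eq0 -mulr2n -mulr_natl mulf_eq0 (negPf two_neq0).
Qed.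

(** Each blade but 1 has trace 0: [e 3] anticommutes with [b], [J], [b' * e 3] and [J * e 3], and
    [J] with [e 3] and [c' * e 3]. Both commute with [c], which is a combination of products of two
    distinct generators. *)
Lemma atrace_decomposition x al b c be al' b' c' be' :
    decomposition e x al b c be al' b' c' be' ->
  atrace x = al * 16%:R.
Proof.
move=> [[bV bV'] [cB cB'] ->].
have sqJ_neq0 : sqJ != 0.
  by apply: contra_eq_neq sqJ_sqr => ->; rewrite mul0r eq_sym oner_eq0.
have tr3 a : e 3 * a = - (a * e 3) -> atrace a = 0.
  exact: atrace_anticomm (gen_sqr 3) (eps_neq0 3).
have trJ3 a : J * a = a * J -> atrace (a * e 3) = 0.
  move=> Ja; apply: atrace_anticomm J_sqr sqJ_neq0 _.
  by rewrite mulrA Ja -mulrA -(mulrA a) gen3_anticommJ mulrN opprK.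
have trc : atrace c = 0.
  case/memv_span3: cB => c1 [c2 [c3 ->]].
  by rewrite !atraceD !atraceZ !atrace_gen_mul // !mulr0 !addr0.
rewrite !mulrDl !atraceD -!scalerAl !atraceZ atrace1; case: cl => _ _ _ ->.
rewrite mul1r trc (tr3 b) ?anticomm3_vectors // (tr3 J) ?gen3_anticommJ //.
rewrite (tr3 (b' * e 3)); last by rewrite mulrA anticomm3_vectors // mulNr.
rewrite (tr3 (J * e 3)); last by rewrite mulrA gen3_anticommJ mulNr.
rewrite (trJ3 c') -?commJ_bivectors // -[e 3]mul1r trJ3 ?mul1r ?mulr1 //.
by rewrite !mulr0 !addr0.
Qed.

End Clifford.

Lemma sqr_eqN1_atrace (R : rcfType) (A : falgType R) (x : A) :
  x ^+ 2 = -1 -> atrace x = 0.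
Proof.
move=> xx; apply: mxtrace_sqrN1.
by rewrite -rmul_mxM -expr2 xx -scaleN1r rmul_mxZ rmul_mx1 scaleN1r.
Qed.

Theorem mainTheorem2 (R : realType) (p q : nat) (A : falgType R)
    (e : 'I_4 -> A) :
  (p + q = 4)%N -> clifford_algebra p e ->
  let J := e123 e in
  let eps4 := eps R p 3 in
  (forall x : A, exists! t : R * A * A * R * (R * A * A * R),
     let: (al, b, c, be, (al', b', c', be')) := t in
     decomposition e x al b c be al' b' c' be')
  /\
  forall (x : A) (al : R) (b c : A) (be : R) (al' : R) (b' c' : A) (be' : R),
  decomposition e x al b c be al' b' c' be' ->
  (* (1) *)
  (al != 0 -> x ^+ 2 <> -1)
  /\
  (* (2) *)
  (al = 0 -> al' != 0 ->
     (x ^+ 2 = -1 <->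
      [/\ c = al'^-1 *: wedge_vv b' b,
          c' = al'^-1 *: ((be' *: b' - (eps4 * be) *: b) * J)
        & b ^+ 2 + (al' ^+ 2)^-1 *: wedge_vv b' b ^+ 2
          + be ^+ 2 *: J ^+ 2 + (eps4 * al' ^+ 2)%:A - eps4 *: b' ^+ 2
          + (eps4 / al' ^+ 2) *:
              ((be' *: b' - (eps4 * be) *: b) ^+ 2 * J ^+ 2)
          - (eps4 * be' ^+ 2) *: J ^+ 2 = -1]))
  /\
  (* (3) *)
  (al = 0 -> al' = 0 -> b' = 0 ->
     [/\ (* (3a) *)
         be = 0 -> be' = 0 ->
           (x ^+ 2 = -1 <->
            [/\ dot_bb c c' = 0, dot_vb b c' = 0, wedge_vb b c = 0
              & b ^+ 2 + c ^+ 2 + eps4 *: c' ^+ 2 = -1]),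
         (* (3b) *)
         be = 0 -> be' != 0 ->
           (x ^+ 2 = -1 <->
            c = - (be'^-1 *: (dot_vb b c' * J^-1)) /\
            b ^+ 2 + (be' ^+ 2)^-1 *: (dot_vb b c' ^+ 2 * J ^+ 2)
            + eps4 *: c' ^+ 2 - (eps4 * be' ^+ 2) *: J ^+ 2 = -1)
       & (* (3c) *)
         be != 0 ->
           (x ^+ 2 = -1 <->
            [/\ b = 0, c = 0
              & be ^+ 2 *: J ^+ 2 + eps4 *: c' ^+ 2
                - (eps4 * be' ^+ 2) *: J ^+ 2 = -1])])
  /\
  (* (4) *)
  (al = 0 -> al' = 0 -> b' != 0 ->
     [/\ (* (4a) *)
         b = 0 -> be = 0 ->
           (x ^+ 2 = -1 <->
            [/\ be' = 0, dot_bb c c' = 0, dot_vb b' c' = 0, wedge_vb b' c = 0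
              & c ^+ 2 - eps4 *: b' ^+ 2 + eps4 *: c' ^+ 2 = -1]),
         (* (4b) *)
         b = 0 -> be != 0 ->
           (x ^+ 2 = -1 <->
            [/\ be' = 0, c = - ((eps4 / be) *: (dot_vb b' c' * J^-1))
              & (be ^+ 2)^-1 *: (dot_vb b' c' ^+ 2 * J ^+ 2)
                + be ^+ 2 *: J ^+ 2 - eps4 *: b' ^+ 2 + eps4 *: c' ^+ 2 = -1]),
         (* (4c) *)
         b != 0 -> be = 0 ->
           (x ^+ 2 = -1 <->
            [/\ be' = 0, dot_bb c c' = 0, wedge_vb b c = 0, dot_vb b c' = 0
              & exists ga : R,
                  [/\ ga != 0, b' = ga *: b
                    & (1 - eps4 * ga ^+ 2) *: b ^+ 2 + c ^+ 2
                      + eps4 *: c' ^+ 2 = -1]])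
       & (* (4d) *)
         b != 0 -> be != 0 ->
           (x ^+ 2 = -1 <->
            [/\ be' != 0, b' = (eps4 * (be / be')) *: b,
                c = - (be'^-1 *: (dot_vb b c' * J^-1))
              & (1 - eps4 * (be ^+ 2 / be' ^+ 2)) *: b ^+ 2
                + (be' ^+ 2)^-1 *: (dot_vb b c' ^+ 2 * J ^+ 2)
                + be ^+ 2 *: J ^+ 2 + eps4 *: c' ^+ 2
                - (eps4 * be' ^+ 2) *: J ^+ 2 = -1])]).
Proof.
move=> _ cl J eps4; have two_neq0 : 2 != 0 :> R by rewrite pnatr_eq0.
split=> [x|x al b c be al' b' c' be' dec].
  have [al [b [c [be [al' [b' [c' [be' dec]]]]]]]] :=
    decomposition_exists cl two_neq0 x.
  exists (al, b, c, be, (al', b', c', be')); split=> //.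
  move=> [[[[al1 b1] c1] be1] [[[al1' b1'] c1'] be1']].
  exact: (decomposition_inj cl two_neq0 dec).
have dec0 : al = 0 -> decomposition e x 0 b c be al' b' c' be' by move=> <-.
split; last split; last split.
(* The trace of [x] is both 0 and [al * 16]. *)
- move=> al_neq0 /sqr_eqN1_atrace/eqP.
  rewrite (atrace_decomposition cl two_neq0 dec) mulf_eq0 (negPf al_neq0).
  by rewrite pnatr_eq0.
- by move=> /dec0{}dec0; apply: (sqr_eqN1_case2 cl two_neq0 dec0).
- move=> /dec0{}dec0 al'0 b'0; split.
  + by move=> be0 be'0; apply: (sqr_eqN1_case3a cl two_neq0 dec0).
  + by move=> be0 be'0; apply: (sqr_eqN1_case3b cl two_neq0 dec0).
  + by move=> be0; apply: (sqr_eqN1_case3c cl two_neq0 dec0).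
move=> /dec0{}dec0 al'0 b'0; split.
- by move=> b0 be0; apply: (sqr_eqN1_case4a cl two_neq0 dec0).
- by move=> b0 be0; apply: (sqr_eqN1_case4b cl two_neq0 dec0).
- by move=> b0 be0; apply: (sqr_eqN1_case4c cl two_neq0 dec0).
- by move=> b0 be0; apply: (sqr_eqN1_case4d cl two_neq0 dec0).
Qed.
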